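(* For any algebra $A$ over $R$ and any $R$-linear mapping $f:V\to A$ satisfying $f(x)^2=B(x,x)\,1_A$ for all $x\in V$, there exists a unique algebra morphism $F:W\to A$ which extends $f$.
   Context: Setting: $R$ is a commutative ring with unit $1\neq 0$; $V\neq\{0\}$ is a free unitary $R$-module with basis $(e_i\mid i\in M)$, where the index set $M$ (possibly infinite) is totally ordered by $<$; $B:V\times V\to R$ is a bilinear form which is diagonal in this basis, i.e. $B(e_i,e_j)=0$ for $i\ne j$; and $q(i)=B(e_i,e_i)$. $\mathcal{F}$ is the set of finite subsets of $M$, and $W=\bigoplus_{\mathcal{F}}R$ is the free $R$-module with basis $(e_K\mid K\in\mathcal{F})$. $V$ is regarded as a submodule of $W$ by identifying $e_i$ with $e_{\{i\}}$. $H\triangle J=(H\cup J)\setminus(H\cap J)$. For $H,J\in\mathcal{F}$: $\alpha(H,J)=\prod(-1)$ over all $(i,j)\in H\times J$ with $j<i$; $\beta(H,J)=\prod_{i\in H\cap J}q(i)$; $\sigma(H,J)=\alpha(H,J)\,\beta(H,J)$ (empty products equal $1$). $W$ is the associative unital $R$-algebra with unit $e_\emptyset$ whose product is the bilinear extension of $e_He_J=\sigma(H,J)\,e_{H\triangle J}$. An algebra is an $R$-module with an $R$-bilinear associative composition having a unit $1_A$; algebra morphisms map unit to unit. *)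

(* Defs.v *)
From HB Require Import structures.
From mathcomp Require Import all_boot all_order all_algebra finmap.
From mathcomp Require Import monalg.

Set Implicit Arguments.
Unset Strict Implicit.
Unset Printing Implicit Defensive.

Import Order.TTheory GRing.Theory.

Local Open Scope fset_scope.
Local Open Scope ring_scope.

(* [algType R] requires [1 != 0]; an algebra here is only a module with an
   associative unital bilinear product, so the zero algebra is included. *)
Record pzAlgType (R : comNzRingType) := PzAlg {
  pzalg_lmod : lmodType R;
  pzalg_mul : pzalg_lmod -> pzalg_lmod -> pzalg_lmod;
  pzalg_one : pzalg_lmod;
  pzalg_mul_linearl : forall y, linear (pzalg_mul^~ y);
  pzalg_mul_linearr : forall x, linear (pzalg_mul x);
  pzalg_mulA : associative pzalg_mul;
  pzalg_mul1r : left_id pzalg_one pzalg_mul;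
  pzalg_mulr1 : right_id pzalg_one pzalg_mul
}.

Definition pzalg_sort (R : comNzRingType) (A : pzAlgType R) : Type :=
  pzalg_lmod A.
Coercion pzalg_sort : pzAlgType >-> Sortclass.

HB.instance Definition _ (R : comNzRingType) (A : pzAlgType R) :=
  GRing.Lmodule.copy (pzalg_sort A) (pzalg_lmod A).

Section PzAlgRing.
Variables (R : comNzRingType) (A : pzAlgType R).

Fact pzalg_mulDl : left_distributive (@pzalg_mul R A) +%R.
Proof.
by move=> x y z; rewrite -[x]scale1r [LHS](pzalg_mul_linearl z) !scale1r.
Qed.

Fact pzalg_mulDr : right_distributive (@pzalg_mul R A) +%R.
Proof.
by move=> x y z; rewrite -[y]scale1r [LHS](pzalg_mul_linearr x) !scale1r.
Qed.

HB.instance Definition _ := GRing.Zmodule_isPzRing.Build (pzalg_sort A)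
  (@pzalg_mulA R A) (@pzalg_mul1r R A) (@pzalg_mulr1 R A)
  pzalg_mulDl pzalg_mulDr.

End PzAlgRing.

Section Basis.
Variables (R : comNzRingType) (I : choiceType) (V : lmodType R).

Definition lincomb (e : I -> V) (c : {malg R[I]}) : V :=
  \sum_(i <- msupp c) c@_i *: e i.

Definition is_basis (e : I -> V) : Prop :=
  forall v, exists! c : {malg R[I]}, v = lincomb e c.

Lemma lincombw (e : I -> V) (c : {malg R[I]}) (D : {fset I}) :
  msupp c `<=` D -> lincomb e c = \sum_(i <- D) c@_i *: e i.
Proof.
move=> le; rewrite /lincomb (big_fset_incl _ le) //= => k _ /mcoeff_outdom ->.
by rewrite scale0r.
Qed.

Lemma lincomb_is_linear e : linear (lincomb e).
Proof.
move=> a c1 c2; pose D := msupp c1 `|` msupp c2.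
have le1 : msupp c1 `<=` D by exact: fsubsetUl.
have le2 : msupp c2 `<=` D by exact: fsubsetUr.
have le3 : msupp (a *: c1 + c2) `<=` D.
  apply: fsubset_trans (msuppD_le _ _) _.
  by apply: fsetSU; exact: msuppZ_le.
rewrite (lincombw e le1) (lincombw e le2) (lincombw e le3).
rewrite scaler_sumr -big_split /=; apply: eq_bigr => i _.
by rewrite mcoeffD mcoeffZ scalerDl scalerA.
Qed.

HB.instance Definition _ e :=
  GRing.isLinear.Build R {malg R[I]} V *:%R (lincomb e) (lincomb_is_linear e).

Lemma lincombU e i : lincomb e << i >> = e i.
Proof. by rewrite (lincombw e msuppU_le) big_seq_fset1 mcoeffUU scale1r. Qed.

Variables (e : I -> V) (eB : is_basis e).

Fact coord_subproof v : exists c, lincomb e c == v.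
Proof. by have [c [-> _]] := eB v; exists c. Qed.

Definition coord v : {malg R[I]} := xchoose (coord_subproof v).

Lemma coordK : cancel coord (lincomb e).
Proof. by move=> v; apply/eqP; exact: xchooseP (coord_subproof v). Qed.

Lemma lincombK : cancel (lincomb e) coord.
Proof.
move=> c; have [c' [_ uc]] := eB (lincomb e c).
by rewrite -(uc (coord _)) ?coordK // -(uc c).
Qed.

Lemma coord_is_linear : linear coord.
Proof.
move=> a u v; apply: (can_inj lincombK).
by rewrite linearP /= !coordK.
Qed.

HB.instance Definition _ :=
  GRing.isLinear.Build R V {malg R[I]} *:%R coord coord_is_linear.

Lemma coord_basis i : coord (e i) = << i >>.
Proof. by rewrite -[e i]lincombU lincombK. Qed.

End Basis.

Section Sigma.
Variables (R : comNzRingType) (d : Order.disp_t) (M : orderType d).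
Variable q : M -> R.
Implicit Types H J K : {fset M}.

Definition symdiff H J : {fset M} := (H `|` J) `\` (H `&` J).

Definition alpha H J : R :=
  \prod_(i <- H) \prod_(j <- J | (j < i)%O) (-1).

Definition beta H J : R := \prod_(i <- H `&` J) q i.

Definition sigma H J : R := alpha H J * beta H J.

Lemma in_symdiff H J i : (i \in symdiff H J) = (i \in H) (+) (i \in J).
Proof. by rewrite !inE; do 2!case: (i \in _). Qed.

Lemma symdiffA : associative symdiff.
Proof. by move=> H J K; apply/fsetP=> i; rewrite !in_symdiff addbA. Qed.

Lemma symdiff0f : left_id fset0 symdiff.
Proof. by move=> H; apply/fsetP=> i; rewrite !in_symdiff !inE. Qed.

Lemma symdifff0 : right_id fset0 symdiff.
Proof. by move=> H; apply/fsetP=> i; rewrite !in_symdiff !inE addbF. Qed.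

Lemma prod_fset_mem (F : M -> R) (A D : {fset M}) : A `<=` D ->
  \prod_(i <- A) F i = \prod_(i <- D) (if i \in A then F i else 1).
Proof.
move=> sAD; rewrite -(big_fset_incl _ sAD) => [|i _ /negPf ->] //.
by rewrite [LHS]big_seq [RHS]big_seq; apply: eq_bigr => i ->.
Qed.

Lemma prod_symdiff (F : M -> R) H J : (forall i, F i * F i = 1) ->
  \prod_(i <- symdiff H J) F i = \prod_(i <- H) F i * \prod_(i <- J) F i.
Proof.
move=> FF; have [sH sJ] := (fsubsetUl H J, fsubsetUr H J).
rewrite (prod_fset_mem F sH) (prod_fset_mem F sJ).
rewrite (@prod_fset_mem F (symdiff H J) (H `|` J)) ?fsubsetDl //.
rewrite -big_split /=; apply: eq_bigr => i _; rewrite in_symdiff.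
by case: (i \in H); case: (i \in J); rewrite /= ?FF ?mulr1 ?mul1r.
Qed.

Lemma alphaDl H J K : alpha (symdiff H J) K = alpha H K * alpha J K.
Proof.
apply: prod_symdiff => i; rewrite -big_split /=.
by rewrite big1 // => j _; rewrite mulrNN mulr1.
Qed.

Lemma alphaDr H J K : alpha H (symdiff J K) = alpha H J * alpha H K.
Proof.
rewrite /alpha -big_split /=; apply: eq_bigr => i _.
rewrite !(big_mkcond (fun j => (j < i)%O)) /=.
by apply: prod_symdiff => j; case: ifP; rewrite ?mulrNN mulr1.
Qed.

Lemma betaA H J K : beta H J * beta (symdiff H J) K =
                    beta J K * beta H (symdiff J K).
Proof.
pose D := H `|` J `|` K; rewrite /beta.
have E (A : {fset M}) : (forall i, i \in A -> i \in D) ->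
    \prod_(i <- A) q i = \prod_(i <- D) (if i \in A then q i else 1).
  by move=> /fsubsetP; exact: prod_fset_mem.
rewrite !E; try by move=> i; rewrite !(inE, in_symdiff);
  case: (i \in H); case: (i \in J); case: (i \in K).
rewrite -!big_split /=; apply: eq_bigr => i _; rewrite !(inE, in_symdiff).
by case: (i \in H); case: (i \in J); case: (i \in K);
  rewrite /= ?mulr1 ?mul1r.
Qed.

Lemma sigmaA H J K : sigma H J * sigma (symdiff H J) K =
                     sigma J K * sigma H (symdiff J K).
Proof.
rewrite /sigma alphaDl alphaDr mulrACA betaA [RHS]mulrACA; congr (_ * _).
by rewrite mulrA [RHS]mulrC.
Qed.

Lemma prod_fset0 (F : M -> R) : \prod_(i <- fset0) F i = 1.
Proof. by rewrite big_seq big1 // => i; rewrite in_fset0. Qed.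

Lemma sigma0f H : sigma fset0 H = 1.
Proof. by rewrite /sigma /alpha /beta fset0I !prod_fset0 mulr1. Qed.

Lemma sigmaf0 H : sigma H fset0 = 1.
Proof.
rewrite /sigma /beta fsetI0 prod_fset0 mulr1 /alpha.
by rewrite big1 // => i _; rewrite big_seq_cond big1.
Qed.

End Sigma.

(* The algebra [W] attached to [q]; an alias of [{malg R[{fset M}]}], the free
   module on the finite subsets of [M], carrying the product twisted by
   [sigma q]. *)
Definition setalg (R : comNzRingType) (d : Order.disp_t) (M : orderType d)
  (q : M -> R) : Type := {malg R[{fset M}]}.

HB.instance Definition _ R d M q :=
  GRing.Lmodule.copy (@setalg R d M q) {malg R[{fset M}]}.

Section SetAlg.
Variables (R : comNzRingType) (d : Order.disp_t) (M : orderType d).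
Variable q : M -> R.
Local Notation W := (setalg q).
Implicit Types (H J K : {fset M}) (g : W).

Definition setbasis K : W := << K >>.

Definition setmul (g1 g2 : W) : W :=
  \sum_(H <- msupp g1) \sum_(J <- msupp g2)
    (g1@_H * g2@_J * sigma q H J) *: setbasis (symdiff H J).

Fact setbasisP : is_basis setbasis.
Proof.
have E (c : {malg R[{fset M}]}) : lincomb setbasis c = c.
  rewrite {2}[c]monalgE; apply: eq_bigr => K _; apply/malgP => J.
  by rewrite mcoeffZ !mcoeffU mulrnAr mulr1.
by move=> g; exists g; split=> [|c ->]; rewrite E.
Qed.

Lemma setmulw (D1 D2 : {fset {fset M}}) g1 g2 :
  msupp g1 `<=` D1 -> msupp g2 `<=` D2 ->
  setmul g1 g2 = \sum_(H <- D1) \sum_(J <- D2)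
    (g1@_H * g2@_J * sigma q H J) *: setbasis (symdiff H J).
Proof.
move=> le1 le2; rewrite /setmul (big_fset_incl _ le1) /=.
  apply/eq_bigr=> H _; apply/big_fset_incl => // J _ /mcoeff_outdom ->.
  by rewrite mulr0 mul0r scale0r.
move=> H _ /mcoeff_outdom g1H.
by rewrite big1 // => J _; rewrite g1H !mul0r scale0r.
Qed.

Lemma setmul_linearl g : linear (setmul^~ g).
Proof.
move=> a g1 g2; pose D := msupp g1 `|` msupp g2.
have le1 : msupp g1 `<=` D by exact: fsubsetUl.
have le2 : msupp g2 `<=` D by exact: fsubsetUr.
have le3 : msupp (a *: g1 + g2) `<=` D.
  apply: fsubset_trans (msuppD_le _ _) _.
  by apply: fsetSU; exact: msuppZ_le.
have lg := fsubset_refl (msupp g).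
rewrite /= (setmulw le1 lg) (setmulw le2 lg) (setmulw le3 lg).
rewrite scaler_sumr -big_split /=; apply: eq_bigr => H _.
rewrite scaler_sumr -big_split /=; apply: eq_bigr => J _.
by rewrite mcoeffD mcoeffZ !mulrDl scalerDl scalerA !mulrA.
Qed.

Lemma setmul_linearr g : linear (setmul g).
Proof.
move=> a g1 g2; pose D := msupp g1 `|` msupp g2.
have le1 : msupp g1 `<=` D by exact: fsubsetUl.
have le2 : msupp g2 `<=` D by exact: fsubsetUr.
have le3 : msupp (a *: g1 + g2) `<=` D.
  apply: fsubset_trans (msuppD_le _ _) _.
  by apply: fsetSU; exact: msuppZ_le.
have lg := fsubset_refl (msupp g).
rewrite /= (setmulw lg le1) (setmulw lg le2) (setmulw lg le3).
rewrite scaler_sumr -big_split /=; apply: eq_bigr => H _.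
rewrite scaler_sumr -big_split /=; apply: eq_bigr => J _.
rewrite mcoeffD mcoeffZ mulrDr mulrDl scalerDl scalerA.
by rewrite !mulrA [a * _]mulrC.
Qed.

Lemma setmul_basis H J :
  setmul (setbasis H) (setbasis J) = sigma q H J *: setbasis (symdiff H J).
Proof.
by rewrite (setmulw msuppU_le msuppU_le) !big_seq_fset1 !mcoeffUU !mul1r.
Qed.

Lemma setalg_ind (P : W -> Prop) :
  (forall a g1 g2, P g1 -> P g2 -> P (a *: g1 + g2)) ->
  (forall K, P (setbasis K)) -> forall g, P g.
Proof.
move=> PD PB g; have [c [-> _]] := setbasisP g; rewrite /lincomb.
have P0 : P 0 by rewrite -(addNr (setbasis fset0)) -scaleN1r; apply: PD.
by elim/big_rec: _ => // K h _ Ph; apply: PD.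
Qed.

Lemma setmulZl a g1 g : setmul (a *: g1) g = a *: setmul g1 g.
Proof.
have z : setmul 0 g = 0 by rewrite /setmul msupp0 big_seq_fset0.
by rewrite -[a *: g1]addr0 [LHS](setmul_linearl g) z addr0.
Qed.

Lemma setmulZr a g g1 : setmul g (a *: g1) = a *: setmul g g1.
Proof.
have z : setmul g 0 = 0.
  by rewrite /setmul big1 // => H _; rewrite msupp0 big_seq_fset0.
by rewrite -[a *: g1]addr0 [LHS](setmul_linearr g) z addr0.
Qed.

Lemma setmulA : associative setmul.
Proof.
have Dl a g1 g2 g : setmul (a *: g1 + g2) g = a *: setmul g1 g + setmul g2 g.
  exact: (setmul_linearl g).
have Dr a g1 g2 g : setmul g (a *: g1 + g2) = a *: setmul g g1 + setmul g g2.
  exact: (setmul_linearr g).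
elim/setalg_ind => [a x1 x2 h1 h2 y z|H]; first by rewrite !Dl h1 h2.
elim/setalg_ind => [a y1 y2 h1 h2 z|J]; first by rewrite !(Dl, Dr) h1 h2.
elim/setalg_ind => [a z1 z2 h1 h2|K]; first by rewrite !Dr h1 h2.
by rewrite !(setmul_basis, setmulZl, setmulZr) !scalerA sigmaA symdiffA.
Qed.

Lemma setmul1g : left_id (setbasis fset0) setmul.
Proof.
elim/setalg_ind => [a x y hx hy|K].
  by rewrite [LHS](setmul_linearr (setbasis fset0)) hx hy.
by rewrite setmul_basis sigma0f symdiff0f scale1r.
Qed.

Lemma setmulg1 : right_id (setbasis fset0) setmul.
Proof.
elim/setalg_ind => [a x y hx hy|K].
  by rewrite [LHS](setmul_linearl (setbasis fset0)) hx hy.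
by rewrite setmul_basis sigmaf0 symdifff0 scale1r.
Qed.

Lemma setmulDl : left_distributive setmul +%R.
Proof.
by move=> x y z; rewrite -[x]scale1r [LHS](setmul_linearl z) !scale1r.
Qed.

Lemma setmulDr : right_distributive setmul +%R.
Proof.
by move=> z x y; rewrite -[x]scale1r [LHS](setmul_linearr z) !scale1r.
Qed.

Lemma setbasis0_neq0 : setbasis fset0 != 0.
Proof.
by apply/eqP => /malgP/(_ fset0)/eqP; rewrite mcoeffUU mcoeff0 oner_eq0.
Qed.

HB.instance Definition _ := GRing.Zmodule_isNzRing.Build W
  setmulA setmul1g setmulg1 setmulDl setmulDr setbasis0_neq0.

Lemma setalgZAl (a : R) (x y : W) : a *: (x * y) = (a *: x) * y.
Proof. by rewrite [RHS]setmulZl. Qed.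

HB.instance Definition _ := GRing.Lmodule_isLalgebra.Build R W setalgZAl.

Lemma setalgZAr (a : R) (x y : W) : a *: (x * y) = x * (a *: y).
Proof. by rewrite [RHS]setmulZr. Qed.

HB.instance Definition _ := GRing.Lalgebra_isAlgebra.Build R W setalgZAr.

Lemma setbasis0 : setbasis fset0 = 1.
Proof. by []. Qed.

Lemma setbasisM H J :
  setbasis H * setbasis J = sigma q H J *: setbasis (symdiff H J).
Proof. exact: setmul_basis. Qed.

Variables (V : lmodType R) (e : M -> V) (eB : is_basis e).

(* The identification of [V] with a submodule of [W], sending [e i] to
   [setbasis [fset i]]. *)
Definition setembed (v : V) : W :=
  lincomb (fun i => setbasis [fset i]) (coord eB v).

Lemma setembed_is_linear : linear setembed.
Proof. by move=> a u v; rewrite /setembed !linearP. Qed.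

HB.instance Definition _ :=
  GRing.isLinear.Build R V W *:%R setembed setembed_is_linear.

Lemma setembed_basis i : setembed (e i) = setbasis [fset i].
Proof. by rewrite /setembed coord_basis lincombU. Qed.

Lemma setembed_inj : injective setembed.
Proof.
pose b i : {malg R[{fset M}]} := << [fset i] >>.
have E c i : (lincomb b c)@_[fset i] = c@_i.
  rewrite /lincomb [RHS](congr1 _ (monalgE c)) !raddf_sum /=.
  apply: eq_bigr => k _; rewrite [LHS]mcoeffZ !mcoeffU mulrnAr mulr1.
  by rewrite (inj_eq (@fset1_inj _)).
move=> u v euv; apply: (can_inj (coordK eB)); apply/malgP => i.
by rewrite -!E; congr mcoeff; exact: euv.
Qed.

End SetAlg.

(* Main.v *)
Require Import Defs.
From HB Require Import structures.
From mathcomp Require Import all_boot all_order all_algebra finmap.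
From mathcomp Require Import monalg.

Set Implicit Arguments.
Unset Strict Implicit.
Unset Printing Implicit Defensive.

Import Order.TTheory GRing.Theory.
Local Open Scope ring_scope.

(** [W] is presented by generators [e_i] with relations [e_i e_i = q(i)] and
    [e_i e_j = - e_j e_i] for [i <> j].  The family [f(e_i)] satisfies the same
    relations: the first is the hypothesis at [e_i], the second its
    polarization at [e_i, e_j], where [B] vanishes.

    For [i] below all of [K] there is no sign and no common index in
    [e_i e_K], so [e_i e_K] is the basis vector of [{i} U K]
    ([setbasis_cons]).  Hence every [e_K] is the increasing product of its
    generators: this forces the value of an extension on [e_K], whence
    uniqueness ([setalg_morph_eq]), and dictates its definition, [cliffext].

    Multiplicativity of [cliffext] reduces to left multiplication by one
    generator, [F(e_i w) = f(e_i) F(w)] ([cliffext_genM]), as each [e_H] is a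
    product of generators and [W] is associative.  For [w = e_K] one moves
    [e_i] to the right past the smaller elements of [K], using the two
    relations in [W] and in [A] simultaneously. *)

(** * Increasing products over finite sets *)

Section AscendingProducts.
Variables (d : Order.disp_t) (M : orderType d).
Implicit Types (i : M) (K : {fset M}).

Definition below i K := forall j, j \in K -> (i < j)%O.

Lemma below_notin i K : below i K -> i \notin K.
Proof. by move=> iK; apply/negP => /iK; rewrite ltxx. Qed.

Lemma sort_below i K : below i K ->
  sort <=%O (i |` K)%fset = i :: sort <=%O (K : seq M).
Proof.
move=> iK; have iNK := below_notin iK.
apply: (sorted_eq le_trans le_anti).
- exact: (sort_sorted le_total).
- rewrite /= path_min_sorted ?(sort_sorted le_total) //.
  by apply/allP => j; rewrite mem_sort => /iK /ltW.
- rewrite perm_sort; apply: uniq_perm; rewrite ?fset_uniq //=.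
    by rewrite mem_sort iNK sort_uniq fset_uniq.
  by move=> j; rewrite in_fset1U inE mem_sort.
Qed.

(** The induction adapted to increasing products: a nonempty finite set is its
    least element added below the rest. *)
Lemma fset_below_ind (P : {fset M} -> Prop) :
  P fset0 -> (forall i K, below i K -> P K -> P (i |` K)%fset) ->
  forall K, P K.
Proof.
move=> P0 PU K; elim: {K}#|` K | {-2}K (erefl #|` K |) => [|n IHn] K cK.
  by rewrite (cardfs0_eq cK).
have : size (sort <=%O (K : seq M)) = n.+1 by rewrite size_sort.
have : sorted <=%O (sort <=%O (K : seq M)) by apply: (sort_sorted le_total).
have : sort <=%O (K : seq M) =i K by move=> j; rewrite mem_sort.
case: (sort _ _) => [|i s] //= mem_s sorted_s _.
have iK : i \in K by rewrite -mem_s mem_head.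
rewrite -(fsetD1K iK); apply: PU => [j|].
  rewrite in_fsetD1 -mem_s inE => /andP[jNi].
  rewrite (negPf jNi) /= => js; rewrite lt_neqAle eq_sym jNi.
  by move: sorted_s; rewrite (path_sortedE le_trans) => /andP[/allP/(_ j js)].
by apply: IHn; apply/eqP; rewrite -eqSS -cK (cardfsD1 i K) iK.
Qed.

Variables (S : pzSemiRingType) (g : M -> S).

Definition ascprod K : S := \prod_(i <- sort <=%O (K : seq M)) g i.

Lemma ascprod0 : ascprod fset0 = 1.
Proof.
rewrite /ascprod; suff -> : sort <=%O (fset0 : seq M) = [::] by rewrite big_nil.
by apply: size0nil; rewrite size_sort cardfs0.
Qed.

Lemma ascprod_below i K : below i K ->
  ascprod (i |` K)%fset = g i * ascprod K.
Proof. by move=> iK; rewrite /ascprod sort_below // big_cons. Qed.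

End AscendingProducts.

(** * Generators and relations in the set algebra *)

Section Generators.
Variables (R : comNzRingType) (d : Order.disp_t) (M : orderType d).
Variable q : M -> R.
Implicit Types (i j : M) (K : {fset M}).

Definition setgen i : setalg q := setbasis q [fset i]%fset.

Lemma setbasis_cons i K : below i K ->
  setbasis q (i |` K)%fset = setgen i * setbasis q K.
Proof.
move=> iK; have iNK := below_notin iK.
have iIK : ([fset i] `&` K)%fset = fset0.
  by apply/eqP; rewrite -/(fdisjoint _ _) fdisjoint1X.
rewrite setbasisM /sigma /alpha /beta /symdiff iIK prod_fset0 fsetD0 mulr1.
rewrite big_seq_fset1 big_seq_cond big1 ?scale1r // => j /andP[/iK ij].
by rewrite ltNge (ltW ij).
Qed.

Lemma alpha11 i j : alpha R [fset i]%fset [fset j]%fset =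
  if (j < i)%O then -1 else 1.
Proof. by rewrite /alpha !(big_seq_fset1, big_mkcond (fun j => (j < _)%O)). Qed.

Lemma setgenK i : setgen i * setgen i = q i *: 1.
Proof.
rewrite setbasisM /sigma alpha11 ltxx mul1r /beta fsetIid big_seq_fset1.
by rewrite /symdiff fsetIid fsetUid fsetDv.
Qed.

Lemma setgenC i j : i != j -> setgen i * setgen j = - (setgen j * setgen i).
Proof.
move=> ij; have dij : ([fset i] `&` [fset j] = fset0 :> {fset M})%fset.
  by apply/eqP; rewrite -/(fdisjoint _ _) fdisjoint1X in_fset1.
rewrite !setbasisM /sigma !alpha11 /beta /symdiff [in RHS]fsetIC.
rewrite [in RHS]fsetUC dij prod_fset0 fsetD0 !mulr1 -scaleNr.
by case: ltgtP ij => //; rewrite ?opprK.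
Qed.

Lemma setalg_morph_eq (A : pzAlgType R)
    (F G : {lrmorphism setalg q -> A}) :
  (forall i, F (setgen i) = G (setgen i)) -> F =1 G.
Proof.
move=> FG; apply: setalg_ind => [a x y Fx Fy|K].
  by rewrite !linearP /= Fx Fy.
elim/fset_below_ind: K => [|i K iK IH]; first by rewrite setbasis0 !rmorph1.
by rewrite setbasis_cons // !rmorphM /= FG IH.
Qed.

End Generators.

(** * Extending a Clifford family *)

Section PzAlgScale.
Variables (R : comNzRingType) (A : pzAlgType R).
Implicit Types (a : R) (x y : A).

Lemma pzalg_scaleAl a x y : a *: x * y = a *: (x * y).
Proof.
rewrite -[a *: x]addr0 [LHS](pzalg_mul_linearl y).
by rewrite [X in _ + X]mul0r addr0.
Qed.

Lemma pzalg_scaleAr a x y : x * (a *: y) = a *: (x * y).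
Proof.
rewrite -[a *: y]addr0 [LHS](pzalg_mul_linearr x).
by rewrite [X in _ + X]mulr0 addr0.
Qed.

End PzAlgScale.

Section Extension.
Variables (R : comNzRingType) (d : Order.disp_t) (M : orderType d).
Variables (q : M -> R) (A : pzAlgType R) (g : M -> A).
Hypothesis gK : forall i, g i * g i = q i *: (1 : A).
Hypothesis gC : forall i j, i != j -> g i * g j = - (g j * g i).

Definition cliffext (w : setalg q) : A := lincomb (ascprod g) w.

Fact cliffext_is_linear : linear cliffext.
Proof. exact: lincomb_is_linear. Qed.

HB.instance Definition _ :=
  GRing.isLinear.Build R (setalg q) A *:%R cliffext cliffext_is_linear.

Lemma cliffext_basis K : cliffext (setbasis q K) = ascprod g K.
Proof. exact: lincombU. Qed.

Lemma cliffext1 : cliffext 1 = 1.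
Proof. by rewrite -setbasis0 cliffext_basis ascprod0. Qed.

Lemma cliffext_below i K : below i K ->
  cliffext (setgen q i * setbasis q K) = g i * cliffext (setbasis q K).
Proof.
by move=> iK; rewrite -setbasis_cons // !cliffext_basis ascprod_below.
Qed.

(** A product [e_i e_K] is a multiple of [e_L] with [L] included in
    [{i} U K], so a bound below [i] and [K] survives multiplication by [e_i].
    This lets [cliffext_below] apply again after a transposition. *)
Lemma cliffext_below_gen j i K : (j < i)%O -> below j K ->
  cliffext (setgen q j * (setgen q i * setbasis q K)) =
    g j * cliffext (setgen q i * setbasis q K).
Proof.
move=> ji jK; rewrite (setbasisM q [fset i]%fset K) -scalerAr !linearZ /=.
rewrite cliffext_below ?pzalg_scaleAr // => k; rewrite in_symdiff in_fset1.
by case: eqP => [->|_] //= /jK.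
Qed.

(** For [w = e_K] with [j] the least element of [K], the cases [i < j],
    [j < i] and [i = j] are respectively the definition of [cliffext], the
    anticommutation relation (after which [i] meets a smaller set), and the
    square relation. *)
Lemma cliffext_genM i w : cliffext (setgen q i * w) = g i * cliffext w.
Proof.
elim/setalg_ind: w => [a x y hx hy|K].
  by rewrite mulrDr -scalerAr !linearP /= hx hy mulrDr pzalg_scaleAr.
elim/fset_below_ind: K => [|j K jK IH].
  by apply: cliffext_below => j; rewrite in_fset0.
have [ij|ji|->] := ltgtP i j.
- apply: cliffext_below => k; rewrite in_fset1U => /predU1P[->//|/jK].
  exact: lt_trans.
- rewrite setbasis_cons // mulrA setgenC ?gt_eqF // mulNr -mulrA linearN /=.
  rewrite cliffext_below_gen // IH cliffext_below // !mulrA -mulNr -gC //.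
  by rewrite gt_eqF.
- rewrite setbasis_cons // cliffext_below // !mulrA.
  by rewrite setgenK gK -scalerAl mul1r linearZ /= pzalg_scaleAl mul1r.
Qed.

Fact cliffext_is_monoid_morphism : monoid_morphism cliffext.
Proof.
split=> [|x w]; first exact: cliffext1.
elim/setalg_ind: x => [a x y hx hy|K].
  by rewrite mulrDl -scalerAl !linearP /= hx hy mulrDl pzalg_scaleAl.
elim/fset_below_ind: K => [|i K iK IH].
  by rewrite setbasis0 cliffext1 !mul1r.
by rewrite setbasis_cons // -mulrA !cliffext_genM IH mulrA.
Qed.

HB.instance Definition _ :=
  GRing.isMonoidMorphism.Build (setalg q) A cliffext
    cliffext_is_monoid_morphism.

Lemma cliffext_gen i : cliffext (setgen q i) = g i.
Proof. by rewrite -[setgen q i]mulr1 cliffext_genM cliffext1 mulr1. Qed.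

Lemma cliffext_exists :
  exists F : {lrmorphism setalg q -> A}, forall i, F (setgen q i) = g i.
Proof. by exists cliffext; exact: cliffext_gen. Qed.

End Extension.

(** * Linear maps squaring to a diagonal form *)

Section CliffordMaps.
Variables (R : comNzRingType) (V : lmodType R).

Lemma basis_linear_eq (I : choiceType) (e : I -> V) (eB : is_basis e)
    (U : lmodType R) (f h : {linear V -> U}) :
  (forall i, f (e i) = h (e i)) -> f =1 h.
Proof.
move=> fh v; rewrite -(coordK eB v) /lincomb !linear_sum.
by apply: eq_bigr => i _; rewrite !linearZ /= fh.
Qed.

(** Expand [f (x + y) ^+ 2 = B (x + y) (x + y) *: 1] and cancel the terms in
    [x] alone and in [y] alone. *)
Lemma sqr_polar (B : {biscalar V}) (A : pzAlgType R) (f : {linear V -> A}) :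
  (forall x, f x ^+ 2 = B x x *: (1 : A)) ->
  forall x y, f x * f y + f y * f x = (B x y + B y x) *: (1 : A).
Proof.
move=> f_sqr x y; have := f_sqr (x + y).
rewrite linearD expr2 mulrDl !mulrDr -!expr2 !f_sqr.
rewrite linearDl /= !linearDr /= !scalerDl.
by rewrite !addrA => /addIr; rewrite -!addrA => /addrI; rewrite addrC.
Qed.

End CliffordMaps.

Theorem corollary2 (R : comNzRingType) (d : Order.disp_t) (M : orderType d)
    (V : lmodType R) (V_neq0 : exists v : V, v != 0)
    (e : M -> V) (e_basis : is_basis e)
    (B : {biscalar V}) (B_diag : forall i j : M, i != j -> B (e i) (e j) = 0)
    (A : pzAlgType R) (f : {linear V -> A})
    (f_sqr : forall x : V, f x ^+ 2 = B x x *: (1 : A)) :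
  let q := fun i : M => B (e i) (e i) in
  exists F : {lrmorphism setalg q -> A},
    (forall v : V, F (setembed q e_basis v) = f v) /\
    (forall G : {lrmorphism setalg q -> A},
       (forall v : V, G (setembed q e_basis v) = f v) -> G =1 F).
Proof.
move=> q.
have fK i : f (e i) * f (e i) = q i *: (1 : A) by rewrite -expr2 f_sqr.
have fC i j : i != j -> f (e i) * f (e j) = - (f (e j) * f (e i)).
  move=> ij; apply/eqP; rewrite -addr_eq0 (sqr_polar f_sqr).
  by rewrite !B_diag ?addr0 ?scale0r // eq_sym.
have [F Fe] := cliffext_exists fK fC; exists F; split=> [v|G Gf].
  apply: (basis_linear_eq e_basis (f := F \o setembed q e_basis)) => i /=.
  by rewrite setembed_basis Fe.
by apply: setalg_morph_eq => i; rewrite Fe -Gf setembed_basis.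
Qed.
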